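(* Fix a real number $\alpha$ with $0<\alpha<1$, and let $n,d$ be integers with $4\le d\le n-2$. For every connected unicyclic graph $G$ on $n$ vertices with diameter $d$ we have $SO_{\alpha}(G)\le SO_{\alpha}(U(n,d))$, with equality if and only if $G\cong U(n,d)$.
   Context: All graphs are finite and simple; $d_G(v)$ denotes the degree of a vertex $v$ in $G$. The general Sombor index is $SO_{\alpha}(G)=\sum_{uv\in E(G)}\left(d_G(u)^2+d_G(v)^2\right)^{\alpha}$. A unicyclic graph is a connected graph containing exactly one cycle. For integers $4\le d\le n-2$, $U(n,d)$ is the graph consisting of a path $v_1v_2\cdots v_d$, one extra vertex $u_0$ adjacent to exactly $v_1$ and $v_3$ (so that $v_1v_2v_3u_0v_1$ is a $4$-cycle), and $n-d-1$ further pendant vertices (vertices of degree one) each adjacent to $v_1$. It has $n$ vertices and diameter $d$. *)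

(* Defs.v *)
From HB Require Import structures.
From mathcomp Require Import all_boot all_order all_algebra.
From mathcomp Require Import reals exp.

Set Implicit Arguments.
Unset Strict Implicit.
Unset Printing Implicit Defensive.

Import Order.TTheory GRing.Theory Num.Theory.

Structure sgraph (T : finType) := SGraph {
  adj :> rel T;
  adj_sym : symmetric adj;
  adj_irr : irreflexive adj
}.

Section Graphs.

Variables (T : finType) (G : sgraph T).

Definition degree (v : T) : nat := #|[set w | G v w]|.

Definition edges : {set {set T}} := [set [set p.1; p.2] | p : T * T & G p.1 p.2].

Definition connected : Prop := (0 < #|T|) /\ forall x y : T, connect G x y.

(* The distance is the least k for which there is a walk of length k from x to
   y; its value is #|T| if there is no such walk. *)
Definition dist (x y : T) : nat :=
  find (fun k => [exists p : k.-tuple T, path G x p && (last x p == y)])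
       (iota 0 #|T|).

Definition diameter : nat := \max_(x : T) \max_(y : T) dist x y.

(* A cycle is a subgraph, and is determined by its edge set: the vertex lists
   obtained from c by rotation or reversal represent the same cycle. *)
Definition cycle_edges (c : seq T) : {set {set T}} :=
  [set [set x; next c x] | x in c].

Definition is_cycle (C : {set {set T}}) : Prop :=
  exists c : seq T, [/\ ucycle G c, 3 <= size c & C = cycle_edges c].

Definition unicyclic : Prop := connected /\ exists! C : {set {set T}}, is_cycle C.

(* For an edge f = [set u; v] with u != v, the inner sum over f is
   degree u ^ 2 + degree v ^ 2. *)
Definition SO (R : realType) (alpha : R) : R :=
  (\sum_(f in edges) (((\sum_(v in f) degree v ^ 2)%N)%:R `^ alpha))%R.

End Graphs.

Definition isomorphic (T T' : finType) (G : sgraph T) (H : sgraph T') : Prop :=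
  exists f : T -> T', bijective f /\ forall x y : T, H (f x) (f y) = G x y.

Section GraphU.

Variables (n d : nat).

(* On the vertices 0, ..., n-1: i < d stands for v_(i+1), d stands for u_0, and
   the i > d are the n-d-1 further pendant vertices attached to v_1 = 0.  Each
   edge is listed with its smaller endpoint first. *)
Definition U_arc (i j : nat) : bool :=
  (i < j) && [|| (j == i.+1) && (j < d),
                 ((i == 0) || (i == 2)) && (j == d)
               | (i == 0) && (d < j)].

Definition U_rel : rel 'I_n := [rel i j : 'I_n | U_arc i j || U_arc j i].

Lemma U_rel_sym : symmetric U_rel.
Proof. by move=> i j; apply: orbC. Qed.

Lemma U_rel_irr : irreflexive U_rel.
Proof. by move=> i; rewrite /U_rel /U_arc /= ltnn. Qed.

Definition U : sgraph 'I_n := SGraph U_rel_sym U_rel_irr.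

End GraphU.

(* Main.v *)
Require Import Defs.
From mathcomp Require Import all_boot all_order all_algebra.
From mathcomp Require Import reals sequences exp.
From mathcomp Require Import ring lra zify.

(**
Write f(a, b) = (a^2 + b^2)^alpha, Delta = n - d + 1 and, for x >= 0,
gain x = (x + 2) (f(x + 2, 2) - f(2, 2)), loss t = f(t, 2) - f(t, 1).
Since x^alpha is strictly concave, f(a, b) + f(2, 2) <= f(a, 2) + f(2, b) for
a, b >= 2, strictly when a, b >= 3.  Summing over the edges gives
  SO(G) <= sum_v gain(d(v) - 2) + |E| 8^alpha - sum_(l leaf) loss(d(nbr l)),
with equality for U(n, d).  Here |E| <= n, gain is strictly convex with
gain 0 = 0, loss is decreasing, and sum_v (d(v) - 2)^+ is at most the number of
leaves.  On a geodesic v_0 ... v_d the d - 1 inner vertices are not leaves, and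
neither is some cycle vertex w off the geodesic, so there are at most n - d
leaves.  With fewer leaves the convexity of gain gives a strict inequality.  With
n - d leaves, w is adjacent to some v_i and v_j with |i - j| <= 2, both of degree
at least 3, and convexity of gain leaves only the case of degrees Delta and 3;
then v_1 or v_(d-1) must have degree Delta, hence is adjacent to every vertex off
the geodesic, and G is U(n, d).  The inequalities between powers that remain all
follow from the weighted AM-GM inequality and inequalities between integers.
*)

Set Implicit Arguments.
Unset Strict Implicit.
Unset Printing Implicit Defensive.

Import Order.TTheory GRing.Theory Num.Theory.

(** * Inequalities between powers *)

Section Powers.

Variables (R : realType) (alpha : R).
Hypotheses (alpha_gt0 : (0 < alpha)%R) (alpha_lt1 : (alpha < 1)%R).

Local Open Scope ring_scope.

Definition pw (a : nat) : R := a%:R `^ alpha.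

Lemma pw_gt0 a : (0 < a)%N -> 0 < pw a.
Proof. by move=> a0; apply: powR_gt0; rewrite ltr0n. Qed.

Lemma pw_ge0 a : 0 <= pw a.
Proof. exact: powR_ge0. Qed.

Lemma ltr_pw a b : (a < b)%N -> pw a < pw b.
Proof. by move=> ab; apply: gt0_ltr_powR; rewrite ?nnegrE ?ler0n ?ltr_nat. Qed.

Lemma ler_pw a b : (a <= b)%N -> pw a <= pw b.
Proof. by rewrite leq_eqVlt => /orP[/eqP->//|/ltr_pw/ltW]. Qed.

(** With u = ln z, the bound 1 + t < e^t is used at t = (1 - alpha) u and at t = - alpha u;
    weighting the two estimates by alpha and 1 - alpha cancels the terms in u. *)
Lemma powR_Bernoulli (z : R) : 0 < z -> z != 1 ->
  z `^ alpha < 1 + alpha * (z - 1).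
Proof.
move=> z0 z1; have u0 : ln z != 0 by rewrite ln_eq0.
rewrite /powR (gt_eqF z0); set u := ln z in u0 *.
have zE : z = expR (alpha * u) * expR ((1 - alpha) * u).
  by rewrite -expRD -mulrDl addrC subrK mul1r lnK// posrE.
have oE : 1 = expR (alpha * u) * expR (- (alpha * u)).
  by rewrite -expRD subrr expR0.
set y := expR (alpha * u) in zE oE *.
have y0 : 0 < y by exact: expR_gt0.
have le1 : y * (1 + (1 - alpha) * u) < z.
  rewrite zE ltr_pM2l//; apply: expR_gt1Dx; rewrite mulf_neq0//.
  by rewrite subr_eq0 gt_eqF.
have le2 : y * (1 - alpha * u) < 1.
  rewrite [ltRHS]oE ltr_pM2l//; apply: expR_gt1Dx.
  by rewrite oppr_eq0 mulf_neq0// gt_eqF.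
have := ltr_pM2l alpha_gt0 (y * (1 + (1 - alpha) * u)) z.
have := @ltr_pM2l _ (1 - alpha) _ (y * (1 - alpha * u)) 1.
rewrite subr_gt0 le1 le2 => /(_ alpha_lt1) h2 h1; nra.
Qed.

Lemma pw_tangent p z : (0 < p)%N -> (0 < z)%N -> z != p ->
  pw z < pw p * (1 + alpha * (z%:R / p%:R - 1)).
Proof.
move=> p0 z0 zp.
have p0' : 0 < p%:R :> R by rewrite ltr0n.
have z0' : 0 < z%:R :> R by rewrite ltr0n.
have q1 : z%:R / p%:R != 1 :> R.
  apply: contra zp => /eqP e; rewrite -(eqr_nat R); apply/eqP.
  by rewrite -[LHS](divfK (lt0r_neq0 p0')) e mul1r.
have -> : pw z = pw p * (z%:R / p%:R) `^ alpha.
  rewrite /pw -powRM ?ler0n ?divr_ge0 ?ler0n//; congr (_ `^ _).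
  by rewrite mulrC divfK// gt_eqF.
by rewrite ltr_pM2l ?pw_gt0//; apply: powR_Bernoulli => //; apply: divr_gt0.
Qed.

(** Strict concavity. [key] puts the chord from [a] to [b + h] below [pw] at an inner point [p], by
    weighing the tangent at [p]; its cases [p = a + h] and [p = b] add up to the claim. *)
Lemma pw_diff_decreasing a b h : (0 < a)%N -> (a < b)%N -> (0 < h)%N ->
  pw (b + h) + pw a < pw (a + h) + pw b.
Proof.
move=> a0 ab h0.
have key p : (a < p)%N -> (p < b + h)%N ->
    (b + h - p)%:R * pw a + (p - a)%:R * pw (b + h) < (b + h - a)%:R * pw p.
  move=> ap pb; have p0 : (0 < p)%N by lia.
  have := @pw_tangent p a p0 a0 ltac:(lia).
  have := @pw_tangent p (b + h)%N p0 ltac:(lia) ltac:(lia).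
  rewrite !natrB ?(ltnW ap) ?(ltnW pb) ?(ltnW (ltn_trans ap pb))//.
  have : (p%:R : R) < (b + h)%:R by rewrite ltr_nat.
  have : (a%:R : R) < p%:R by rewrite ltr_nat.
  have : (0 : R) < p%:R by rewrite ltr0n.
  set D := (b + h)%:R; set P := p%:R; set A := a%:R => P0 AP PD.
  move=> h1 h2.
  have {}h1 : (P - A) * pw (b + h) <
      (P - A) * (pw p * (1 + alpha * (D / P - 1))) by rewrite ltr_pM2l ?subr_gt0.
  have {}h2 : (D - P) * pw a <
      (D - P) * (pw p * (1 + alpha * (A / P - 1))) by rewrite ltr_pM2l ?subr_gt0.
  have -> : (D - A) * pw p = (P - A) * (pw p * (1 + alpha * (D / P - 1))) +
      (D - P) * (pw p * (1 + alpha * (A / P - 1))).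
    by field; rewrite gt_eqF.
  by rewrite addrC ltrD.
have := key (a + h)%N ltac:(lia) ltac:(lia).
have := key b ltac:(lia) ltac:(lia).
rewrite (_ : b + h - b = h)%N; last lia.
rewrite (_ : b + h - (a + h) = b - a)%N; last lia.
rewrite (_ : a + h - a = h)%N; last lia.
rewrite (_ : b + h - a = (b - a) + h)%N; last lia.
rewrite natrD => h1 h2.
have : 0 < (b - a)%:R + h%:R :> R by rewrite -natrD ltr0n; lia.
nra.
Qed.

(** Turns a comparison of powers into one of integers, free of [alpha]. By 1 + t <= e^t each [pw a]
    is at least [pw b] times 1 + alpha (ln a - ln b), and the hypothesis makes the weighted sum of
    these logarithms positive. Weight 0 with base 1 drops a term. *)
Lemma pw_AGM (w1 w2 w3 a1 a2 a3 b : nat) :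
  (0 < b)%N -> (0 < a1)%N -> (0 < a2)%N -> (0 < a3)%N ->
  b%:R ^+ (w1 + w2 + w3) < a1%:R ^+ w1 * a2%:R ^+ w2 * a3%:R ^+ w3 :> R ->
  (w1 + w2 + w3)%:R * pw b < w1%:R * pw a1 + w2%:R * pw a2 + w3%:R * pw a3.
Proof.
move=> b0 a10 a20 a30 lt.
have lnE (a m : nat) : (0 < a)%N -> ln (a%:R ^+ m) = m%:R * ln a%:R :> R.
  by move=> a0; rewrite lnXn ?ltr0n// mulr_natl.
have {}lt : (w1 + w2 + w3)%:R * ln b%:R <
    w1%:R * ln a1%:R + w2%:R * ln a2%:R + w3%:R * ln a3%:R :> R.
  rewrite -!lnE// -!lnM ?posrE ?mulr_gt0 ?exprn_gt0 ?ltr0n//.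
  by rewrite -ltr_expR !lnK// posrE ?mulr_gt0 ?exprn_gt0 ?ltr0n.
have le (a m : nat) : (0 < a)%N ->
    m%:R * (pw b * (1 + alpha * (ln a%:R - ln b%:R))) <= m%:R * pw a.
  move=> a0; rewrite ler_wpM2l ?ler0n//.
  have a0' : 0 < a%:R :> R by rewrite ltr0n.
  have b0' : 0 < b%:R :> R by rewrite ltr0n.
  rewrite /pw /powR (gt_eqF a0') (gt_eqF b0').
  rewrite [leRHS](_ : _ = expR (alpha * ln b%:R) *
     expR (alpha * (ln a%:R - ln b%:R))); last by rewrite -expRD; congr expR; ring.
  by rewrite ler_pM2l ?expR_gt0// expR_ge1Dx.
apply: lt_le_trans (lerD (lerD (le a1 w1 a10) (le a2 w2 a20)) (le a3 w3 a30)).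
have pb : 0 < pw b * alpha by rewrite mulr_gt0 ?pw_gt0.
move: lt; rewrite -(ltr_pM2l pb) !natrD; lra.
Qed.

(** * The loss at a leaf and the convex gain of a degree *)

Definition loss (t : nat) : R := pw (t ^ 2 + 4) - pw (t ^ 2 + 1).

Lemma loss_decreasing s t : (s < t)%N -> loss t < loss s.
Proof.
move=> st; have := @pw_diff_decreasing (s ^ 2 + 1) (t ^ 2 + 1) 3 ltac:(lia).
rewrite -!addnA ltn_add2r ltn_sqr st => /(_ isT isT).
by rewrite /loss; lra.
Qed.

Lemma loss_nonincreasing s t : (s <= t)%N -> loss t <= loss s.
Proof. by rewrite leq_eqVlt => /orP[/eqP->//|/loss_decreasing/ltW]. Qed.

Lemma loss_gt0 t : 0 < loss t.
Proof. by rewrite subr_gt0 ltr_pw// ltn_add2l. Qed.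

(** The argument is the excess of a degree over 2; truncated subtraction gives a leaf excess 0,
    hence no gain. *)
Definition gain (x : nat) : R := x.+2%:R * (pw (x.+2 ^ 2 + 4) - pw 8).

Lemma gain0 : gain 0 = 0.
Proof. by rewrite /gain subrr mulr0. Qed.

Lemma gain_increasing x : gain x < gain x.+1.
Proof.
apply: (@le_lt_trans _ _ (x.+3%:R * (pw (x.+2 ^ 2 + 4) - pw 8))).
  by rewrite ler_wpM2r ?ler_nat// subr_ge0 ler_pw//; lia.
by rewrite ltr_pM2l ?ltr0n// ltrD2r ltr_pw//; lia.
Qed.

Lemma ler_gain x y : (x <= y)%N -> gain x <= gain y.
Proof.
elim: y => [|y IHy]; first by rewrite leqn0 => /eqP->.
rewrite leq_eqVlt ltnS => /orP[/eqP->//|/IHy/le_trans]; apply.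
exact/ltW/gain_increasing.
Qed.

Lemma ltr_gain x y : (x < y)%N -> gain x < gain y.
Proof. by move=> xy; apply: lt_le_trans (gain_increasing x) (ler_gain xy). Qed.

(** Bernoulli's inequality for (y / x)^t, cleared of denominators. The induction step has slack t
    x^t (x - y)^2. *)
Lemma Bernoulli_homogeneous (x y : R) t : 0 <= y -> y <= x ->
  x ^+ t * (x - t%:R * (x - y)) <= y ^+ t * x.
Proof.
move=> y0 yx; elim: t => [|t IHt]; first by rewrite !expr0 !mul1r; lra.
have xt : 0 <= x ^+ t by rewrite exprn_ge0//; lra.
have {}IHt := ler_wpM2l y0 IHt.
have tk : 0 <= t%:R * (x - y) ^+ 2 by rewrite mulr_ge0// sqr_ge0.
have := mulr_ge0 xt tk.
rewrite !exprS -natr1; nra.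
Qed.

(* AM-GM reduces convexity to B^(2t+2) < A^(t+2) C^t, for
   A, B, C = (t+2)^2 + 4, (t+1)^2 + 4, t^2 + 4; here t = x + 2. *)
Lemma gain_convex_step x : 2 * gain x.+1 < gain x + gain x.+2.
Proof.
have := @pw_AGM x.+4 x.+2 0 (x.+4 ^ 2 + 4) (x.+2 ^ 2 + 4) 1 (x.+3 ^ 2 + 4)
  ltac:(lia) ltac:(lia) ltac:(lia) isT.
rewrite addn0 expr0 mulr1 mul0r addr0 /gain.
have -> : (x.+4 + x.+2 = x.+3 * 2)%N by lia.
suff lt : (x.+3 ^ 2 + 4)%:R ^+ (x.+3 * 2) <
    (x.+4 ^ 2 + 4)%:R ^+ x.+4 * (x.+2 ^ 2 + 4)%:R ^+ x.+2 :> R.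
  move=> /(_ lt).
  rewrite natrM; set Q := pw 8.
  rewrite (_ : x.+4%:R = x.+3%:R + 1) ?natr1// (_ : x.+2%:R = x.+3%:R - 1); lra.
set B : R := _%:R; set A : R := _%:R; set C : R := _%:R.
pose X : R := x%:R; have X0 : 0 <= X by rewrite ler0n.
have EA : A = (X + 4) ^+ 2 + 4 by rewrite /A natrD natrX -[x.+4]addn4 natrD.
have EB : B = (X + 3) ^+ 2 + 4 by rewrite /B natrD natrX -[x.+3]addn3 natrD.
have EC : C = (X + 2) ^+ 2 + 4 by rewrite /C natrD natrX -[x.+2]addn2 natrD.
have AC0 : 0 <= A * C by rewrite EA EC mulr_ge0// addr_ge0// sqr_ge0.
have ACB : A * C <= B ^+ 2 by rewrite EA EB EC; nra.
have B0 : 0 < B by rewrite EB; nra.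
have := Bernoulli_homogeneous x.+2 AC0 ACB.
rewrite (_ : x.+2%:R = X + 2); last by rewrite -addn2 natrD.
move=> Be.
have -> : A ^+ x.+4 * C ^+ x.+2 = (A * C) ^+ x.+2 * A ^+ 2.
  by rewrite exprMn -[x.+4]addn2 exprD; ring.
have -> : B ^+ (x.+3 * 2) = (B ^+ 2) ^+ x.+2 * B ^+ 2.
  by rewrite mulnC exprM -exprSr.
have Y0 : 0 < (B ^+ 2) ^+ x.+2 by rewrite !exprn_gt0.
have B20 : 0 < B ^+ 2 by rewrite exprn_gt0.
have A20 : 0 <= A ^+ 2 by exact: sqr_ge0.
(* The factor B^2 makes Bernoulli's inequality applicable: (A C)^t B^2 is at least (B^2)^t (B^2 - t
   (B^2 - A C)) for t = x + 2, and a polynomial inequality is left. *)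
rewrite -(ltr_pM2r B20).
apply: (@lt_le_trans _ _ ((B ^+ 2) ^+ x.+2 *
   (B ^+ 2 - (X + 2) * (B ^+ 2 - A * C)) * A ^+ 2)); last first.
  by rewrite [leRHS]mulrAC ler_wpM2r.
move: Y0; move: ((B ^+ 2) ^+ x.+2) => Y Y0.
rewrite -(mulrA Y (B ^+ 2)) -(mulrA Y _ (A ^+ 2)) ltr_pM2l//.
have X2 : 0 <= X ^+ 2 by exact: sqr_ge0.
have X3 : 0 <= X ^+ 3 by exact: exprn_ge0.
(* Both factors are bounded below by multiples of B, which leaves B^2 < (B - 2X - 4) (B + 4X + 14),
   where B is quadratic in X. *)
have E1 : B * (B - 2 * X - 4) <= B ^+ 2 - (X + 2) * (B ^+ 2 - A * C).
  rewrite -subr_ge0 (_ : _ - _ = (X + 2) * 17) ?mulr_ge0 ?addr_ge0//.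
  by rewrite EA EB EC; ring.
have A2 : B * (B + 4 * X + 14) <= A ^+ 2.
  rewrite -subr_ge0 (_ : _ - _ = (2 * X + 7) ^+ 2) ?sqr_ge0//.
  by rewrite EA EB; ring.
have P1 : 0 <= B - 2 * X - 4 by rewrite EB; lra.
have P2 : 0 <= B + 4 * X + 14 by lra.
apply: lt_le_trans (ler_pM (mulr_ge0 (ltW B0) P1) (mulr_ge0 (ltW B0) P2) E1 A2).
rewrite [ltRHS](_ : _ = B ^+ 2 * ((B - 2 * X - 4) * (B + 4 * X + 14))).
  by rewrite ltr_pM2l// EB; lra.
by ring.
Qed.

Lemma gain_exchange x y : (x < y)%N -> gain x.+1 + gain y < gain x + gain y.+1.
Proof.
elim: y => // y IHy; rewrite ltnS leq_eqVlt => /orP[/eqP<-|/IHy].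
  by have := gain_convex_step x; lra.
by have := gain_convex_step y; lra.
Qed.

Lemma gain_spread k i j : (0 < i)%N -> (0 < j)%N ->
  gain (k + i) + gain (k + j) < gain k + gain (k + i + j).
Proof.
elim: i => // i IHi _ j0.
have st : gain (k + i).+1 + gain (k + i + j) < gain (k + i) + gain (k + i + j).+1.
  by apply: gain_exchange; lia.
case: i IHi st => [|i] IHi; rewrite ?addn0 ?addn1 ?addSn ?addnS //.
have := IHi isT j0; rewrite addnS addSn; lra.
Qed.

Lemma gain_superadditive i j : gain i + gain j <= gain (i + j).
Proof.
case: i => [|i]; first by rewrite gain0 add0r.
case: j => [|j]; first by rewrite gain0 addr0 addn0.
by have := @gain_spread 0 i.+1 j.+1 isT isT; rewrite gain0 !add0n add0r => /ltW.
Qed.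

Lemma sum_gain (I : finType) (P : pred I) (x : I -> nat) :
  \sum_(v | P v) gain (x v) <= gain (\sum_(v | P v) x v).
Proof.
apply: (big_ind2 (fun a b => a <= gain b)) => //; first by rewrite gain0.
by move=> a b a' b' ha hb; apply: le_trans (gain_superadditive _ _); apply: lerD.
Qed.

(** Expands to 4 * 8^alpha < 3 * 13^alpha + 5^alpha, which AM-GM derives from 8^4 < 13^3 * 5. *)
Lemma loss2_lt_gain1 : loss 2 < gain 1.
Proof.
have := @pw_AGM 3 1 0 13 5 1 8 isT isT isT isT ltac:(lra) => AGM.
rewrite /loss /gain; rewrite -[(2 ^ 2 + 4)%N]/8%N -[(2 ^ 2 + 1)%N]/5%N.
by rewrite -[(3 ^ 2 + 4)%N]/13%N; lra.
Qed.

(** Expands to 6 * 13^alpha < 4 * 20^alpha + 8^alpha + 5^alpha, from 13^6 < 20^4 * 8 * 5. It serves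
    to exclude excess at a third vertex. *)
Lemma loss2_lt_gain2 : loss 2 + 2 * gain 1 < gain 2.
Proof.
have := @pw_AGM 4 1 1 20 8 5 13 isT isT isT isT ltac:(lra) => AGM.
rewrite /loss /gain; rewrite -[(2 ^ 2 + 4)%N]/8%N -[(2 ^ 2 + 1)%N]/5%N.
by rewrite -[(3 ^ 2 + 4)%N]/13%N -[(4 ^ 2 + 4)%N]/20%N; lra.
Qed.

(** Expands to 8 * 20^alpha < 5 * 29^alpha + 2 * 13^alpha + 10^alpha, from 20^8 < 29^5 * 13^2 * 10.
    It serves for d = 4. *)
Lemma loss3_lt_gain3 : loss 3 + 2 * gain 2 < gain 3 + gain 1.
Proof.
have := @pw_AGM 5 2 1 29 13 10 20 isT isT isT isT ltac:(lra) => AGM.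
rewrite /loss /gain; rewrite -[(3 ^ 2 + 1)%N]/10%N -[(5 ^ 2 + 4)%N]/29%N.
by rewrite -[(3 ^ 2 + 4)%N]/13%N -[(4 ^ 2 + 4)%N]/20%N; lra.
Qed.

Lemma gain_two x y s : (0 < x)%N -> (0 < y)%N -> (x + y <= s.+1)%N ->
  gain x + gain y <= gain s + gain 1.
Proof.
case: x y => [//|[|x]] [//|[|y]] _ _ le; last first.
- have := @gain_spread 1 x.+1 y.+1 isT isT; rewrite !add1n => /ltW/le_trans; apply.
  by rewrite addrC lerD2r ler_gain; lia.
- by rewrite lerD2r ler_gain; lia.
- by rewrite addrC lerD2r ler_gain; lia.
- by rewrite lerD2r ler_gain; lia.
Qed.

(** Two applications of [gain_two] push the excesses to [s - 1], 1 and 1; after one exchange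
    [loss2_lt_gain2] shows that the third part costs more than [loss 2]. *)
Lemma gain_three x y z s : (0 < x)%N -> (0 < y)%N -> (0 < z)%N ->
  (x + y + z <= s.+1)%N -> gain x + gain y + gain z + loss 2 < gain s + gain 1.
Proof.
move=> x0 y0 z0 le.
have h1 : gain x + gain y <= gain (x + y - 1) + gain 1 by apply: gain_two; lia.
have h2 : gain (x + y - 1) + gain z <= gain s.-1 + gain 1 by apply: gain_two; lia.
have h3 : gain s.-1 + gain 2 <= gain s + gain 1.
  rewrite addrC [leRHS]addrC (_ : s = s.-1.+1) /=; last lia.
  have [->|s3] := eqVneq s.-1 1%N; first by rewrite addrC.
  by rewrite ltW// gain_exchange//; lia.
by have := loss2_lt_gain2; lra.
Qed.

(** The best split into parts of size at least 2 is [s - 1] and 2; one exchange and [loss3_lt_gain3]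
    then pay for [loss 3]. *)
Lemma gain_two_big x y s : (1 < x)%N -> (1 < y)%N -> (x + y <= s.+1)%N ->
  gain x + gain y + loss 3 < gain s + gain 1.
Proof.
case: x y => [//|[//|x]] [//|[//|y]] _ _ le.
have h1 : gain x.+2 + gain y.+2 <= gain 2 + gain (2 + x + y).
  case: x y le => [|x] [|y] le; rewrite ?addn0 // 1?addrC ?lexx//.
  by have := @gain_spread 2 x.+1 y.+1 isT isT; rewrite ?add2n addrC => /ltW.
have h2 : gain (2 + x + y) <= gain s.-1 by rewrite ler_gain; lia.
have h3 : gain s.-1 + gain 3 <= gain s + gain 2.
  rewrite addrC [leRHS]addrC (_ : s = s.-1.+1) /=; last lia.
  have [->|s3] := eqVneq s.-1 2%N; first by rewrite addrC.
  by rewrite ltW// gain_exchange//; lia.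
by have := loss3_lt_gain3; lra.
Qed.

(** Each side is 2 P + s Q - (s + 2) 8^alpha, with P and Q the powers of (s + 2)^2 + 4 and (s + 2)^2
    + 1. Raising s by 1 increases P and Q and adds a further Q - 8^alpha >= 0. *)
Lemma leaf_excess_increasing s t : (s <= t)%N ->
  gain s - s%:R * loss s.+2 <= gain t - t%:R * loss t.+2.
Proof.
elim: t => [|t IHt]; first by rewrite leqn0 => /eqP->.
rewrite leq_eqVlt ltnS => /orP[/eqP->//|/IHt/le_trans]; apply.
rewrite /gain /loss -(natr1 t) -[t.+3]addn1 -[t.+2]addn2 !natrD.
have l1 : pw ((t + 2) ^ 2 + 4) <= pw ((t + 2 + 1) ^ 2 + 4) by rewrite ler_pw//; lia.
have l2 : pw ((t + 2) ^ 2 + 1) <= pw ((t + 2 + 1) ^ 2 + 1) by rewrite ler_pw//; lia.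
have l3 : pw 8 <= pw ((t + 2 + 1) ^ 2 + 1) by rewrite ler_pw//; lia.
have := ler_wpM2l (ler0n R t) l2; lra.
Qed.

(** * Splitting the weight of an edge between its endpoints *)

Definition edge_weight (a b : nat) : R := pw (a ^ 2 + b ^ 2).

Definition dgain (t : nat) : R := pw (maxn t 2 ^ 2 + 4) - pw 8.

(** The first two terms each depend on one endpoint only, so they sum to a sum over vertices.
    [dgain] treats degree 1 like degree 2, and the [loss] terms correct this at leaves. *)
Definition edge_bound (a b : nat) : R :=
  dgain a + dgain b + pw 8 - (b == 1%N)%:R * loss a - (a == 1%N)%:R * loss b.

Lemma edge_weight_lt a b : (2 < a)%N -> (2 < b)%N ->
  edge_weight a b < edge_bound a b.
Proof.
move=> a2 b2; rewrite /edge_weight /edge_bound /dgain.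
rewrite !(maxn_idPl _) ?(ltnW a2) ?(ltnW b2)//.
rewrite !gtn_eqF ?(ltnW a2) ?(ltnW b2)// !mul0r !subr0.
(* Adding a^2 - 4 raises the power less at b^2 + 4 than at 8. *)
have := @pw_diff_decreasing 8 (b ^ 2 + 4) (a ^ 2 - 4) isT ltac:(nia) ltac:(nia).
rewrite (_ : b ^ 2 + 4 + (a ^ 2 - 4) = a ^ 2 + b ^ 2)%N; last nia.
by rewrite (_ : 8 + (a ^ 2 - 4) = a ^ 2 + 4)%N; [lra | nia].
Qed.

Lemma edge_weight_le a b : (0 < a)%N -> (0 < b)%N -> (2 < a + b)%N ->
  edge_weight a b <= edge_bound a b.
Proof.
wlog ab : a b / (a <= b)%N.
  move=> wl a0 b0 ab2; case: (leqP a b) => [/wl|/ltnW/wl]; first exact.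
  rewrite addnC => /(_ b0 a0 ab2); rewrite /edge_weight addnC /edge_bound; lra.
move=> a0 b0 ab2; case: (leqP a 2) => a2; last first.
  by apply/ltW/edge_weight_lt => //; lia.
(* The bound is attained when the smaller degree is 1 or 2. *)
rewrite le_eqVlt; apply/orP; left; apply/eqP.
have b2 : (2 <= b)%N by lia.
rewrite /edge_weight /edge_bound /dgain (maxn_idPr a2) (maxn_idPl b2).
rewrite -[(2 ^ 2 + 4)%N]/8%N subrr add0r subrK (gtn_eqF b2) mul0r subr0.
case: a a0 a2 {ab ab2} => [//|[|[|//]]] _ _ /=.
  rewrite ?mul1r /loss. by rewrite opprB addrC subrK addnC.
by rewrite mul0r subr0 addnC.
Qed.

Lemma mul_dgain t : (0 < t)%N -> t%:R * dgain t = gain (t - 2).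
Proof.
case: t => [//|[|t]] _; rewrite /gain /dgain.
  by rewrite -[(maxn 1 2)]/2%N subrr !mulr0.
by rewrite subn2 /= (maxn_idPl _).
Qed.

End Powers.

(** * Edges, distances and geodesics *)

Section GraphLemmas.

Variables (T : finType) (G : sgraph T).

Lemma adj_neq x y : G x y -> x != y.
Proof. by apply: contraTneq => ->; rewrite adj_irr. Qed.

Lemma mem_edges x y : ([set x; y] \in edges G) = G x y.
Proof.
apply/imsetP/idP => [[[a b]]|xy]; last by exists (x, y); rewrite // inE.
rewrite inE /= => ab /setP e.
have : a \in [set x; y] by rewrite e !inE eqxx.
have : b \in [set x; y] by rewrite e !inE eqxx orbT.
have := e x; have := e y; rewrite !inE !eqxx orbT /=.
have := adj_neq ab; have := ab; have := ab; rewrite {2}adj_sym.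
move=> ba ab' neq; do 2 case/esym/orP => /eqP ?; subst; rewrite ?eqxx //.
all: by do 2 case/orP => /eqP ?; subst; rewrite ?eqxx // in neq *.
Qed.

Lemma sum_adjacent_pairs (V : nmodType) (h : {set T} -> V) :
  (\sum_(p : T * T | G p.1 p.2) h [set p.1; p.2] =
   (\sum_(f in edges G) h f) *+ 2)%R.
Proof.
rewrite (partition_big (fun p : T * T => [set p.1; p.2]) (mem (edges G))) /=;
  last by case=> a b /=; rewrite mem_edges.
rewrite -sumrMnl; apply: eq_bigr => f /imsetP[[a b]]; rewrite inE /= => ab ->.
rewrite (eq_bigl (mem [set (a, b); (b, a)])).
  rewrite big_setU1 ?big_set1 /=; last first.
    by rewrite inE xpair_eqE negb_and (adj_neq ab).
  by rewrite [[set b; a]]setUC mulr2n.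
case=> x y /=; rewrite !inE !xpair_eqE /=; apply/andP/orP.
  case=> xy /eqP/setP e.
  have := e x; have := e y; rewrite !inE !eqxx orbT /=.
  have := adj_neq xy.
  move=> neq; do 2 case/esym/orP => /eqP ?; subst; rewrite ?eqxx // in neq *.
  by right. by left.
by case=> /andP[/eqP-> /eqP->]; rewrite ?(adj_sym _ b) ab // setUC.
Qed.

Lemma card_adjacent : #|[set p : T * T | G p.1 p.2]| = (#|edges G|).*2.
Proof.
have := @sum_adjacent_pairs nat (fun=> 1); rewrite mulr2n => e.
by rewrite -addnn -[in RHS]sum1_card -sum1_card -[RHS]e; apply: eq_bigl => p; rewrite inE.
Qed.

Lemma handshake : \sum_v degree G v = (#|edges G|).*2.
Proof.
rewrite -card_adjacent -sum1_card.
under [RHS]eq_bigl => p do rewrite inE.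
rewrite -(pair_big_dep xpredT (fun x y => G x y) (fun _ _ => 1)) /=.
by apply: eq_bigr => v _; rewrite sum1_card /degree cardsE.
Qed.

Lemma dist_le x p : path G x p -> dist G x (last x p) <= size p.
Proof.
move=> xp; rewrite /dist leqNgt; apply/negP => lt.
have := before_find 0 lt.
rewrite nth_iota; last first.
  by apply: leq_trans lt _; rewrite -[leqRHS](size_iota 0) find_size.
rewrite add0n => /existsP; apply.
by exists (in_tuple p); rewrite /= xp eqxx.
Qed.

Lemma dist_walk x y : connect G x y ->
  exists p, [/\ path G x p, last x p = y & size p = dist G x y].
Proof.
case/connectP => p0 /shortenP[p xp up _] ->.
(* A simple path has fewer than [#|T|] edges, so the search defining [dist] succeeds within its
   range. *)
have lt : size p < #|T|.
  by apply: leq_trans (max_card (mem (x :: p))); rewrite (card_uniqP up).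
have hs : has (fun k => [exists q : k.-tuple T, path G x q && (last x q == last x p)])
   (iota 0 #|T|).
  apply/hasP; exists (size p); first by rewrite mem_iota.
  by apply/existsP; exists (in_tuple p); rewrite xp eqxx.
have := nth_find 0 hs; rewrite nth_iota -?[find _ _]/(dist G x (last x p)); last first.
  by move: hs; rewrite has_find size_iota.
rewrite add0n => /existsP[q /andP[xq /eqP lq]].
by exists q; rewrite size_tuple.
Qed.

Lemma degree_ge (s : seq T) x : uniq s -> {in s, forall y, G x y} ->
  size s <= degree G x.
Proof.
move=> us sx; rewrite /degree cardsE -(card_uniqP us); apply: subset_leq_card.
by apply/subsetP => y /sx.
Qed.

Lemma fundamental_cycle (S : {set {set T}}) x y : S \subset edges G -> G x y ->
  [set x; y] \notin S -> connect (fun a b => [set a; b] \in S) x y ->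
  exists C, [/\ is_cycle G C, [set x; y] \in C & C \subset [set x; y] |: S].
Proof.
move=> sub xy nS /connectP[p0 /shortenP[p xp up _]] yE.
have cyc : cycle (fun a b => [set a; b] \in [set x; y] |: S) (x :: p).
  rewrite /= rcons_path -yE in_setU1 [[set y; x]]setUC eqxx andbT.
  by apply: sub_path xp => a b; rewrite in_setU1 => ->; rewrite orbT.
have cycG : cycle G (x :: p).
  apply: sub_cycle cyc => a b; rewrite -mem_edges in_setU1 => /predU1P[->|].
    by rewrite mem_edges.
  exact: (subsetP sub).
exists (cycle_edges (x :: p)); split.
- exists (x :: p); split => //; first by rewrite /ucycle cycG.
  (* A path of length 0 would make the edge a loop, and one of length 1 would put it in [S]. *)
  case: p xp yE {up cyc cycG} => [|z [|//]] /=.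
    by move=> _ yE; rewrite yE adj_irr in xy.
  by rewrite andbT => xz yE; rewrite yE xz in nS.
- apply/imsetP; exists y; first by rewrite yE mem_last.
  rewrite next_nth yE mem_last index_last//.
  by rewrite nth_default// setUC.
- by apply/subsetP => _ /imsetP[z zc ->]; apply: next_cycle cyc _.
Qed.

(** Joining each vertex to a parent nearer to the root [r] gives a spanning tree [S]. Two edges
    outside [S] would have fundamental cycles that coincide by uniqueness, yet the cycle of the
    second avoids the first. *)
Lemma unicyclic_edges : unicyclic G -> #|edges G| <= #|T|.
Proof.
case=> -[/card_gt0P[r _] conn] [C0 [_ uC0]].
have /fin_all_exists[par parP] v : exists u, v != r -> G u v /\ dist G r u < dist G r v.
  have [p [rp lp sp]] := dist_walk (conn r v).
  case/lastP: p rp lp sp => [_ <- _|p z]; first by exists r; rewrite eqxx.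
  rewrite rcons_path last_rcons size_rcons => /andP[rp uz] zv <-.
  exists (last r p) => _; rewrite -zv uz; split => //.
  by rewrite ltnS dist_le.
pose S := [set [set par v; v] | v in [set~ r]].
have subS : S \subset edges G.
  apply/subsetP => _ /imsetP[v vr ->]; rewrite !inE in vr.
  by have [vv _] := parP v vr; rewrite mem_edges.
have cardS : #|S| < #|T|.
  apply: leq_ltn_trans (leq_imset_card _ _) _.
  by rewrite cardsC1 ltn_predL; apply/card_gt0P; exists r.
pose e a b := [set a; b] \in S.
have syme : symmetric e by move=> a b; rewrite /e setUC.
have conr v : connect e r v.
  have [m] := ubnP (dist G r v); elim: m v => // m IHm v lt.
  have [->|/[dup] vr /parP[_ lt']] := eqVneq v r; first exact: connect0.
  apply: connect_trans (IHm (par v) _) _; first by lia.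
  by apply/connect1/imsetP; exists v; rewrite ?inE.
have cone x y : connect e x y.
  by apply: connect_trans (conr y); rewrite (sym_connect_sym syme).
rewrite -(cardsID S) (setIidPr subS).
suff le1 : #|edges G :\: S| <= 1.
  by apply: leq_trans cardS; rewrite -addn1 leq_add2l.
rewrite leqNgt; apply/negP => /card_gt1P[f [g [fE gE neq]]].
have cyc h : h \in edges G :\: S ->
    exists C, [/\ is_cycle G C, h \in C & C \subset h |: S].
  rewrite inE => /andP[nS /imsetP[[x y]]]; rewrite inE /= => xy hE; subst h.
  exact: fundamental_cycle.
have [Cf [/uC0 <- fC _]] := cyc f fE.
have [Cg [/uC0 <- _ /subsetP sub]] := cyc g gE.
have := sub f fC; rewrite in_setU1 (negPf neq) /=.
by move: fE; rewrite inE => /andP[/negPf->].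
Qed.

End GraphLemmas.

Lemma next_neq_prev (T : eqType) (c : seq T) x :
  uniq c -> 2 < size c -> x \in c -> next c x != prev c x.
Proof.
move=> uc c3 /rot_to[i p e].
rewrite -(next_rot i uc) -(prev_rot i uc) e.
have : uniq (x :: p) by rewrite -e rot_uniq.
have : 2 < size (x :: p) by rewrite -e size_rot.
case: p {e} => [|y [|z p]] // _ => /and4P[xnot ynot _ _].
rewrite next_nth prev_nth !mem_head index_head (memNindex xnot) /=.
rewrite -[nth x _ _]/(nth x (z :: p) (size (z :: p)).-1) nth_last /=.
by apply: contraNneq ynot => ->; rewrite mem_last.
Qed.

(** * Geodesics and their position relative to the cycle *)

Section Geodesic.

Variables (T : finType) (G : sgraph T).

(** Only the values of [v] at 0, ..., [d] matter. Minimality is stated against arbitrary walks, so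
    that explicit detours can be tested directly. *)
Definition geodesic (v : nat -> T) (d : nat) : Prop :=
  (forall i, i < d -> G (v i) (v i.+1)) /\
  (forall i j p, i <= j <= d -> path G (v i) p -> last (v i) p = v j ->
    j - i <= size p).

Lemma diameter_geodesic d : connected G -> diameter G = d ->
  exists v, geodesic v d.
Proof.
case=> T0 conn dE.
have [x xE] := @bigop.eq_bigmax T (fun x => \max_y dist G x y) T0.
have [y yE] := @bigop.eq_bigmax T (dist G x) T0.
have dxy : dist G x y = d by rewrite -dE -yE -xE.
have [p [xp lp]] := dist_walk (conn x y); rewrite dxy => sp.
have lastE i : i <= d -> last x (take i p) = nth x (x :: p) i.
  move=> id; rewrite (last_nth x) size_takel ?sp//.
  by case: i id => //= i id; rewrite nth_take.
exists (nth x (x :: p)); split=> [i id|i j q /andP[ij jd] iq lq].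
  by have /(pathP x)/(_ i) := xp; rewrite sp => ->.
(* With the stretch from [i] to [j] replaced by [q], the walk still joins [x] to [y], so its length
   is at least [d]. *)
pose r := take i p ++ q ++ drop j p.
have rp : path G x r.
  rewrite !cat_path lastE ?(leq_trans ij)// iq lq -lastE//.
  have := xp; rewrite -{1}(cat_take_drop i p) cat_path => /andP[-> _].
  by move: xp; rewrite -{1}(cat_take_drop j p) cat_path => /andP[_ ->].
have lr : last x r = y.
  rewrite !last_cat lastE ?(leq_trans ij)// lq -lastE// -last_cat.
  by rewrite cat_take_drop.
have := dist_le rp; rewrite lr dxy !size_cat size_takel ?size_drop; lia.
Qed.

Lemma geodesic_rev v d : geodesic v d -> geodesic (fun i => v (d - i)) d.
Proof.
case=> va vg; split=> [i id|i j p /andP[ij jd] ip lp].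
  by rewrite adj_sym (_ : d - i = (d - i.+1).+1) ?va; lia.
have := vg (d - j) (d - i) (rev (belast (v (d - i)) p)).
rewrite size_rev size_belast -lp rev_path.
rewrite (eq_path (e' := G)); last by move=> a b; rewrite adj_sym.
move=> h; suff: d - i - (d - j) <= size p by lia.
apply: h => //; first lia.
by case: p {ip lp} => //= z p; rewrite rev_cons last_rcons.
Qed.

Section Fixed.

Variables (v : nat -> T) (d : nat).
Hypothesis vg : geodesic v d.

Lemma geodesic_inj i j : i <= d -> j <= d -> v i = v j -> i = j.
Proof.
wlog ij : i j / i <= j.
  by move=> wl id jd e; case: (leqP i j) => [/wl|/ltnW/wl]; [|symmetry]; auto.
by move=> id jd e; have := vg.2 i j [::]; rewrite ij jd /= => /(_ isT isT e); lia.
Qed.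

Lemma geodesic_adj i j : i <= d -> j <= d -> G (v i) (v j) -> j = i.+1 \/ i = j.+1.
Proof.
wlog ij : i j / i <= j.
  move=> wl id jd e; case: (leqP i j) => [/wl|/ltnW/wl]; first exact.
  by rewrite adj_sym => /(_ jd id e)[]; [right|left].
move=> id jd e; have := vg.2 i j [:: v j]; rewrite ij jd /= e => /(_ isT isT erefl).
have : i != j by apply: contraTneq e => ->; rewrite adj_irr.
by move=> ?; left; lia.
Qed.

Lemma geodesic_common_neighbor w i j : i <= d -> j <= d -> G w (v i) -> G w (v j) ->
  j <= i.+2.
Proof.
move=> id jd wi wj; case: (leqP i j) => [ij|]; last lia.
have := vg.2 i j [:: w; v j]; rewrite ij jd /= adj_sym wi wj => /(_ isT isT erefl).
by lia.
Qed.

Definition on_geodesic : {set T} := [set v (i : 'I_d.+1) | i in 'I_d.+1].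

Lemma on_geodesicP x : reflect (exists2 i, i <= d & x = v i) (x \in on_geodesic).
Proof.
apply: (iffP imsetP) => [[i _ ->]|[i id ->]]; first by exists i => //; rewrite -ltnS.
by exists (Ordinal (id : i < d.+1)).
Qed.

Lemma card_on_geodesic : #|on_geodesic| = d.+1.
Proof.
rewrite card_imset ?card_ord// => i j e; apply/val_inj/geodesic_inj => //=.
all: by rewrite -ltnS ltn_ord.
Qed.

(** A cycle inside the geodesic would have a vertex of least index [i], whose two distinct cycle
    neighbours would both be [v i.+1]. For a cycle vertex [w] off the geodesic, [a] and [b] are its
    cycle neighbours. *)
Lemma cycle_off_geodesic C : is_cycle G C ->
  exists w a b, [/\ w \notin on_geodesic, a != b, G w a /\ G w b
    & 1 < degree G a /\ 1 < degree G b].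
Proof.
case=> c [/andP[cyc uc] c3 _].
have nb x : x \in c -> [/\ G x (next c x), G x (prev c x) & next c x != prev c x].
  move=> xc; split; [exact: next_cycle|rewrite adj_sym; exact: prev_cycle|].
  exact: next_neq_prev.
have deg x : x \in c -> 1 < degree G x.
  move=> /nb[xn xp neq]; apply: (@degree_ge _ _ [:: next c x; prev c x]).
    by rewrite /= inE neq.
  by move=> y; rewrite !inE => /orP[] /eqP->.
have [/allP call|/allPn[w wc wn]] := boolP (all (mem on_geodesic) c); last first.
  have [wnx wpr neq] := nb w wc; exists w, (next c w), (prev c w); split => //.
  by split; apply: deg; rewrite ?mem_next ?mem_prev.
have : exists i, (i <= d) && (v i \in c).
  case: c c3 call {cyc uc nb deg} => // x c _ /(_ x); rewrite mem_head.
  by move=> /(_ isT)/on_geodesicP[i id ->]; exists i; rewrite id mem_head.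
case/ex_minnP => i /andP[id ic] imin.
have succ y : y \in c -> G (v i) y -> y = v i.+1.
  move=> yc; have /on_geodesicP[j jd yE] := call y yc.
  rewrite yE in yc *; case/(geodesic_adj id jd) => [->//|iE].
  by have := imin j; rewrite jd yc => /(_ isT); lia.
have [inx ipr neq] := nb _ ic.
have nE : next c (v i) = v i.+1 by apply: succ inx; rewrite mem_next.
have pE : prev c (v i) = v i.+1 by apply: succ ipr; rewrite mem_prev.
by move: neq; rewrite nE pE eqxx.
Qed.

End Fixed.

End Geodesic.

(** * The edge bound *)

Lemma sum_adjacent (V : nmodType) (T : finType) (G : sgraph T) (F : T -> T -> V) :
  (\sum_(p : T * T | G p.1 p.2) F p.1 p.2 = \sum_x \sum_(y | G x y) F x y)%R.
Proof. by rewrite pair_big_dep. Qed.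

Lemma sum_adjacent_swap (V : nmodType) (T : finType) (G : sgraph T) (F : T -> T -> V) :
  (\sum_(p : T * T | G p.1 p.2) F p.2 p.1 = \sum_(p : T * T | G p.1 p.2) F p.1 p.2)%R.
Proof.
rewrite (reindex_inj (h := fun p : T * T => (p.2, p.1))) /=.
  by apply: eq_bigl => p; rewrite adj_sym.
by move=> [a b] [a' b'] [-> ->].
Qed.

Lemma sum_adjacent_weight (R : realType) (alpha : R) (T : finType) (G : sgraph T) :
  (\sum_(p : T * T | G p.1 p.2) edge_weight alpha (degree G p.1) (degree G p.2) =
   SO G alpha *+ 2)%R.
Proof.
rewrite -(sum_adjacent_pairs _
  (fun f => ((\sum_(v in f) degree G v ^ 2)%N%:R `^ alpha)%R)).
apply: eq_bigr => -[a b] /= ab; rewrite big_setU1 ?big_set1//.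
by rewrite inE (adj_neq ab).
Qed.

Lemma SO_isomorphic (R : realType) (alpha : R) (T T' : finType)
    (G : sgraph T) (G' : sgraph T') :
  isomorphic G G' -> SO G alpha = SO G' alpha.
Proof.
case=> f [bijf fE].
have degE x : degree G' (f x) = degree G x.
  rewrite /degree -(card_imset _ (bij_inj bijf)); congr #|pred_of_set _|.
  case: bijf => g fK gK; apply/setP => y; rewrite inE -(gK y) fE.
  by rewrite (mem_imset _ _ (can_inj fK)) inE.
suff : (SO G alpha *+ 2 = SO G' alpha *+ 2)%R by lra.
pose F (S : finType) (K : sgraph S) x y := edge_weight alpha (degree K x) (degree K y).
rewrite -!sum_adjacent_weight (sum_adjacent G (F _ G)) (sum_adjacent G' (F _ G')).
rewrite [RHS](reindex f) /=; last exact: onW_bij.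
apply: eq_bigr => x _; rewrite [RHS](reindex f) /=; last exact: onW_bij.
by apply: eq_big => [y|y _]; rewrite /F ?fE ?degE.
Qed.

Section ConnectedDegrees.

Variables (T : finType) (G : sgraph T).
Hypotheses (conn : connected G) (card3 : 2 < #|T|).

Lemma degree_gt0 x : 0 < degree G x.
Proof.
have [y] : exists y, y \in [set~ x] by apply/card_gt0P; rewrite cardsC1; lia.
rewrite !inE => yx; case/connectP: (conn.2 x y) => -[|z p] /=.
  by move=> _ e; rewrite e eqxx in yx.
by case/andP=> xz _ _; apply: (@degree_ge _ _ [:: z]) => // u; rewrite inE => /eqP->.
Qed.

Lemma adj_leaf x y z : degree G x = 1 -> G x y -> G x z -> z = y.
Proof.
move=> dx xy xz; apply/eqP; apply: contra_eqT dx => zy.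
rewrite gtn_eqF//; apply: (@degree_ge _ _ [:: z; y]); first by rewrite /= inE zy.
by move=> u; rewrite !inE => /orP[]/eqP->.
Qed.

(** Two adjacent leaves would form a whole component of a connected graph with at least three
    vertices. *)
Lemma adj_degree x y : G x y -> 2 < degree G x + degree G y.
Proof.
move=> xy; have dx := degree_gt0 x; have dy := degree_gt0 y.
rewrite leqNgt; apply/negP; rewrite ltnS => le2.
have dx1 : degree G x = 1 by lia.
have dy1 : degree G y = 1 by lia.
have yx : G y x by rewrite adj_sym.
have cl : closed G (mem [set x; y]).
  apply: intro_closed => [|a b ab].
    by apply: sym_connect_sym; exact: adj_sym.
  rewrite !inE => /orP[]/eqP e; subst a.
    by rewrite (adj_leaf dx1 xy ab) eqxx orbT.
  by rewrite (adj_leaf dy1 yx ab) eqxx.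
suff : #|T| <= #|[set x; y]| by rewrite cards2; case: (x != y); lia.
rewrite -cardsT; apply/subset_leq_card/subsetP => z _.
by rewrite -(closed_connect cl (conn.2 x z)) !inE eqxx.
Qed.

End ConnectedDegrees.

Section EdgeBound.

Variables (R : realType) (alpha : R).
Hypotheses (alpha_gt0 : (0 < alpha)%R) (alpha_lt1 : (alpha < 1)%R).
Variables (T : finType) (G : sgraph T).

Definition leaves : {set T} := [set x | degree G x == 1].

Definition leaf_loss (x : T) : R := (\sum_(y | G x y) loss alpha (degree G y))%R.

Definition SO_bound : R :=
  ((\sum_x gain alpha (degree G x - 2)) + #|edges G|%:R * pw alpha 8
   - \sum_(x in leaves) leaf_loss x)%R.

Hypothesis conn : connected G.
Hypothesis card3 : 2 < #|T|.

(** Over ordered pairs, [F1] occurs [degree G x] times at [x] and yields [gain] through [mul_dgain],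
    [F2] survives only at leaves, and every edge counts 8^alpha twice. *)
Lemma sum_edge_bound :
  (\sum_(p : T * T | G p.1 p.2) edge_bound alpha (degree G p.1) (degree G p.2) =
   SO_bound *+ 2)%R.
Proof.
pose F1 x (y : T) : R := dgain alpha (degree G x).
pose F2 x y : R := ((degree G x == 1)%:R * loss alpha (degree G y))%R.
have S1 : (\sum_(p : T * T | G p.1 p.2) F1 p.1 p.2 =
    \sum_x gain alpha (degree G x - 2))%R.
  rewrite (sum_adjacent G F1); apply: eq_bigr => x _.
  by rewrite sumr_const -mul_dgain ?(degree_gt0 conn)// mulr_natl /degree cardsE.
have S2 : (\sum_(p : T * T | G p.1 p.2) F2 p.1 p.2 = \sum_(x in leaves) leaf_loss x)%R.
  rewrite (sum_adjacent G F2) [RHS]big_mkcond; apply: eq_bigr => x _.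
  by rewrite -mulr_sumr inE; case: eqP => _; rewrite ?mul1r ?mul0r.
have S3 : (\sum_(p : T * T | G p.1 p.2) pw alpha 8 = (#|edges G|%:R * pw alpha 8) *+ 2)%R.
  by rewrite (sum_adjacent_pairs G (fun=> pw alpha 8)) sumr_const mulr_natl.
have S1' := sum_adjacent_swap G F1; have S2' := sum_adjacent_swap G F2.
transitivity (\sum_(p : T * T | G p.1 p.2) F1 p.1 p.2 +
  \sum_(p : T * T | G p.1 p.2) F1 p.2 p.1 +
  \sum_(p : T * T | G p.1 p.2) pw alpha 8 -
  \sum_(p : T * T | G p.1 p.2) F2 p.2 p.1 -
  \sum_(p : T * T | G p.1 p.2) F2 p.1 p.2)%R.
  by rewrite -!big_split /= -!sumrB; apply: eq_bigr.
rewrite S1' S2' S1 S2 S3 /SO_bound; ring.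
Qed.

Lemma SO_le_bound : (SO G alpha <= SO_bound)%R.
Proof.
suff : (SO G alpha *+ 2 <= SO_bound *+ 2)%R by lra.
rewrite -sum_adjacent_weight -sum_edge_bound; apply: ler_sum => -[x y] /= xy.
by apply: edge_weight_le; rewrite ?(degree_gt0 conn)// (adj_degree conn).
Qed.

Lemma SO_lt_bound x y : G x y -> 2 < degree G x -> 2 < degree G y ->
  (SO G alpha < SO_bound)%R.
Proof.
move=> xy dx dy; suff : (SO G alpha *+ 2 < SO_bound *+ 2)%R by lra.
rewrite -sum_adjacent_weight -sum_edge_bound.
rewrite (bigD1 (x, y)) //= [ltRHS](bigD1 (x, y)) //=.
apply: ltr_leD; first exact: edge_weight_lt.
apply: ler_sum => -[a b] /= /andP[ab _].
by apply: edge_weight_le; rewrite ?(degree_gt0 conn)// (adj_degree conn).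
Qed.

End EdgeBound.

(** * Graphs that do not attain the bound *)

Ltac nat_lia :=
  repeat match goal with
  | H : ?P |- _ => lazymatch P with
      | is_true (leq _ _) => fail
      | is_true (andb _ _) => fail
      | is_true (negb (@eq_op _ _ _)) => fail
      | @eq nat _ _ => fail
      | @eq nat _ _ \/ _ => fail
      | _ => clear H
      end
  end; lia.

(* [s] stands for n - d - 1, so that [s.+2] is the degree of v_1 in U(n, d). *)
Definition U_value (R : realType) (alpha : R) (n d s : nat) : R :=
  (gain alpha s + gain alpha 1 + n%:R * pw alpha 8 - s%:R * loss alpha s.+2
   - loss alpha (if d == 4 then 3 else 2)%N)%R.

Section Extremal.

Variables (R : realType) (alpha : R).
Hypotheses (alpha_gt0 : (0 < alpha)%R) (alpha_lt1 : (alpha < 1)%R).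
Variables (T : finType) (G : sgraph T) (d s : nat).
Hypotheses (d4 : 4 <= d) (s1 : 0 < s) (cardT : #|T| = d + s.+1).
Hypotheses (conn : connected G) (edges_le : #|edges G| <= #|T|).
Variable v : nat -> T.
Hypothesis vg : geodesic G v d.
Variables w a b : T.
Hypotheses (w_off : w \notin on_geodesic v d) (ab : a != b).
Hypotheses (wa : G w a) (wb : G w b).
Hypotheses (deg_a : 1 < degree G a) (deg_b : 1 < degree G b).

Let deg := degree G.
Let excess x := deg x - 2.

Let card3 : 2 < #|T|.
Proof. by rewrite cardT; lia. Qed.

Let deg_gt0 x : 0 < deg x.
Proof. exact: (degree_gt0 conn card3). Qed.

(** No degree is 0, so degree plus leaf indicator equals excess plus 2 at each vertex; the handshake
    lemma and the bound on the edges conclude. *)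
Lemma sum_excess : \sum_x excess x <= #|leaves G|.
Proof.
have e : \sum_x deg x + #|leaves G| = \sum_x excess x + 2 * #|T|.
  rewrite -sum1_card mulnC -sum_nat_const [X in _ + X = _]big_mkcond -!big_split /=.
  apply: eq_bigr => x _; have := deg_gt0 x; rewrite inE /excess -/(deg x).
  by case: (deg x) => [//|[//|k]] _; rewrite addn0 subnK.
by move: e edges_le; rewrite handshake; lia.
Qed.

Let v_inj i j : i <= d -> j <= d -> v i = v j -> i = j.
Proof. exact: (geodesic_inj vg). Qed.

Let w_neq i : i <= d -> w != v i.
Proof. by move=> id; apply: contraNneq w_off => ->; apply/on_geodesicP; exists i. Qed.

Let v_prev i : 0 < i <= d -> G (v i) (v i.-1).
Proof.
by case: i => // i /= id; rewrite adj_sym vg.1.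
Qed.

Lemma inner_degree i : 0 < i < d -> 1 < deg (v i).
Proof.
move=> id; apply: (@degree_ge _ _ [:: v i.-1; v i.+1]); last first.
  move=> y; rewrite !inE => /orP[]/eqP->; first by apply: v_prev; lia.
  by apply: vg.1; lia.
by rewrite /= inE andbT; apply/eqP => /v_inj; lia.
Qed.

(** These [d] vertices are known not to be leaves, which leaves room for at most [s + 1] leaves. *)
Definition core : {set T} := w |: [set v i.+1 | i : 'I_d.-1].

Lemma coreP x : reflect (x = w \/ exists2 i, 0 < i < d & x = v i) (x \in core).
Proof.
rewrite in_setU1; apply: (iffP predU1P) => -[]; [by left| |by left|].
  by case/imsetP => i _ ->; right; exists i.+1 => //; have := ltn_ord i; lia.
case=> -[//|i] id ->; right.
have id' : i < d.-1 by lia.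
by apply/imsetP; exists (Ordinal id').
Qed.

Lemma card_core : #|core| = d.
Proof.
rewrite cardsU1 card_imset ?card_ord; last first.
  move=> i j /v_inj e; apply: val_inj; apply: succn_inj; apply: e.
    by have := ltn_ord i; lia.
  by have := ltn_ord j; lia.
rewrite (_ : w \notin _); first by lia.
apply/imsetP => -[i _]; apply/eqP/w_neq.
by have := ltn_ord i; lia.
Qed.

Lemma core_degree x : x \in core -> 1 < deg x.
Proof.
case/coreP => [->|[i id ->]]; last exact: inner_degree.
apply: (@degree_ge _ _ [:: a; b]); first by rewrite /= inE ab.
by move=> y; rewrite !inE => /orP[]/eqP->.
Qed.

Lemma leaves_sub : leaves G \subset ~: core.
Proof.
apply/subsetP => x; rewrite inE in_setC => /eqP dx.
by apply/negP => xc; have := core_degree xc; rewrite /deg dx.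
Qed.

Lemma card_leaves_le : #|leaves G| <= s.+1.
Proof.
apply: leq_trans (subset_leq_card leaves_sub) _.
by rewrite -(leq_add2l #|core|) cardsC card_core cardT.
Qed.

Lemma leaf_lossE x y : x \in leaves G -> G x y ->
  leaf_loss alpha G x = loss alpha (deg y).
Proof.
rewrite inE => /eqP dx xy; rewrite /leaf_loss (big_pred1 y)// => z.
apply/idP/eqP => [|->//]; exact: adj_leaf.
Qed.

Lemma leaf_loss_ge M x : (forall y, deg y <= M) -> x \in leaves G ->
  (loss alpha M <= leaf_loss alpha G x)%R.
Proof.
move=> le xl; have /card_gt0P[y] := deg_gt0 x; rewrite inE => xy.
by rewrite (leaf_lossE xl xy) loss_nonincreasing.
Qed.

Lemma sum_leaf_loss_ge M (A : {set T}) : (forall y, deg y <= M) ->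
  A \subset leaves G ->
  (#|A|%:R * loss alpha M <= \sum_(x in A) leaf_loss alpha G x)%R.
Proof.
move=> le /subsetP sub; rewrite mulr_natl -sumr_const.
by apply: ler_sum => x /sub; apply: leaf_loss_ge.
Qed.

(** In U(n, d) the leaf v_d hangs at v_(d-1), which has degree 2 except for d = 4, where it is v_3
    of degree 3. *)
Lemma loss_end_le : (loss alpha (if d == 4 then 3 else 2)%N <= loss alpha 2)%R.
Proof. by case: ifP => _ //; apply: loss_nonincreasing. Qed.

Let edges_term : (#|edges G|%:R * pw alpha 8 <= (d + s.+1)%:R * pw alpha 8)%R.
Proof. by rewrite ler_wpM2r ?pw_ge0// ler_nat -cardT. Qed.

(** With l leaves all degrees are at most l + 2 and the total gain is at most [gain l].
    [leaf_excess_increasing] compares l with [s], and the spare [gain 1] exceeds [loss 2]. *)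
Lemma few_leaves : #|leaves G| <= s -> (SO G alpha < U_value alpha (d + s.+1) d s)%R.
Proof.
move=> ls; set l := #|leaves G| in ls.
have le x : deg x <= l.+2.
  have : excess x <= l by apply: leq_trans sum_excess; rewrite (bigD1 x) //= leq_addr.
  by rewrite /excess; nat_lia.
have h1 := SO_le_bound alpha_gt0 alpha_lt1 conn card3.
have h2 : (\sum_x gain alpha (excess x) <= gain alpha l)%R.
  apply: le_trans (sum_gain alpha_gt0 alpha_lt1 _ _) _.
  exact: ler_gain sum_excess.
have h3 := sum_leaf_loss_ge le (subxx _).
have h4 := leaf_excess_increasing alpha_gt0 alpha_lt1 ls.
have h5 := loss2_lt_gain1 alpha_gt0.
move: h1 h2 h3 h4 h5 loss_end_le edges_term.
rewrite /SO_bound /U_value -/l /excess -/deg; lra.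
Qed.

(** * Graphs with exactly n - d leaves *)

Section FullLeaves.

Hypothesis card_leaves : #|leaves G| = s.+1.

Lemma leavesE : leaves G = ~: core.
Proof.
apply/eqP; rewrite eqEcard leaves_sub card_leaves.
by rewrite -(leq_add2l #|core|) cardsC card_core cardT leqnn.
Qed.

Lemma inner_neighbor x : G w x -> 1 < degree G x -> exists2 i, 0 < i < d & x = v i.
Proof.
move=> wx dx; have : x \in core.
  by rewrite -[core]setCK -leavesE in_setC inE gtn_eqF.
by case/coreP => // xw; move: wx; rewrite xw adj_irr.
Qed.

Lemma attachment_points : exists i j,
  [/\ 0 < i < j, j < d, j <= i.+2, G w (v i) & G w (v j)].
Proof.
have [i id aE] := inner_neighbor wa deg_a; have [j jd bE] := inner_neighbor wb deg_b.
have ij : i != j by apply: contraNneq ab => ij; rewrite aE bE ij.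
have [wi wj] : G w (v i) /\ G w (v j) by rewrite -aE -bE.
have le2 := geodesic_common_neighbor vg.
case: (ltnP i j) => [lt|ge].
  by exists i, j; split=> //; try nat_lia; apply: (le2 w) => //; nat_lia.
by exists j, i; split=> //; try nat_lia; apply: (le2 w) => //; nat_lia.
Qed.

Lemma end_leaf i : i = 0 \/ i = d -> v i \in leaves G.
Proof.
move=> iE; have id : i <= d by nat_lia.
rewrite leavesE in_setC; apply/coreP => -[/eqP|[j jd /v_inj]]; last by nat_lia.
by rewrite eq_sym (negPf (w_neq id)).
Qed.

(** The two ends of the geodesic are leaves with known neighbours; only the other [s - 1] leaves are
    estimated through [M]. *)
Lemma sum_leaf_loss_ends M : (forall y, deg y <= M) ->
  (loss alpha (deg (v 1)) + loss alpha (deg (v d.-1)) + s.-1%:R * loss alpha M <=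
   \sum_(x in leaves G) leaf_loss alpha G x)%R.
Proof.
move=> le; have l0 := end_leaf (or_introl (erefl 0)).
have ld := end_leaf (or_intror (erefl d)).
have neq : v d != v 0 by apply/eqP => /v_inj; nat_lia.
rewrite (big_setD1 (v 0) l0) (big_setD1 (v d)) /=; last by rewrite in_setD1 neq ld.
rewrite (leaf_lossE l0 (vg.1 0 _)); last nat_lia.
rewrite (leaf_lossE ld (v_prev _)); last nat_lia.
rewrite addrA lerD2l.
set A := leaves G :\ v 0 :\ v d.
have <- : #|A| = s.-1.
  have := cardsD1 (v 0) (leaves G); have := cardsD1 (v d) (leaves G :\ v 0).
  by rewrite l0 in_setD1 neq ld card_leaves -/A /=; nat_lia.
apply: sum_leaf_loss_ge => //; exact: subset_trans (subD1set _ _) (subD1set _ _).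
Qed.

(** The surviving case is a 4-cycle v_i v_(i+1) v_(i+2) w with a vertex of degree Delta next to an
    end of the geodesic. All excess is first confined to v_i and v_j; then the losses of the two end
    leaves decide. *)
Lemma full_leaves : (SO G alpha < U_value alpha (d + s.+1) d s)%R \/
  exists i, [/\ 0 < i, i.+2 < d, G w (v i), G w (v i.+2) &
    i = 1 /\ deg (v 1) = s.+2 \/ i.+3 = d /\ deg (v d.-1) = s.+2].
Proof.
have [i [j [/andP[i0 ij] jd ji wi wj]]] := attachment_points.
have branch k : 0 < k < d -> G w (v k) -> 2 < deg (v k).
  move=> kd wk; apply: (@degree_ge _ _ [:: v k.-1; v k.+1; w]); last first.
    move=> y; rewrite !inE => /or3P[]/eqP->; last by rewrite adj_sym.
      by apply: v_prev; nat_lia.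
    by apply: vg.1; nat_lia.
  rewrite /= !inE !negb_or andbT -!(eq_sym w) !w_neq ?andbT; try nat_lia.
  by apply/eqP => /v_inj; nat_lia.
have di : 2 < deg (v i) by apply: branch => //; nat_lia.
have dj : 2 < deg (v j) by apply: branch => //; nat_lia.
have neq : v j != v i by apply/eqP => /v_inj; nat_lia.
have [x xE] : exists x, deg (v i) = x.+2.
  by exists (excess (v i)); rewrite /excess; nat_lia.
have [y yE] : exists y, deg (v j) = y.+2.
  by exists (excess (v j)); rewrite /excess; nat_lia.
have exE : excess (v i) = x by rewrite /excess xE subn2.
have eyE : excess (v j) = y by rewrite /excess yE subn2.
have [rest restE] : exists r, \sum_(u | (u != v i) && (u != v j)) excess u = r.
  by exists (\sum_(u | (u != v i) && (u != v j)) excess u).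
have tot : x + y + rest <= s.+1.
  move: sum_excess; rewrite card_leaves (bigD1 (v i)) //= (bigD1 (v j)) //=.
  by rewrite addnA exE eyE restE.
have x0 : 0 < x by nat_lia.
have y0 : 0 < y by nat_lia.
have rest_ge u : u != v i -> u != v j -> excess u <= rest.
  by move=> ui uj; rewrite -restE (bigD1 u) ?ui //= leq_addr.
have le u : deg u <= s.+2.
  have [->|ui] := eqVneq u (v i); first by clear -tot y0 xE; nat_lia.
  have [->|uj] := eqVneq u (v j); first by clear -tot x0 yE; nat_lia.
  by move: (rest_ge u ui uj) tot; rewrite /excess; clear -x0 y0; nat_lia.
pose leaf_total := (\sum_(u in leaves G) leaf_loss alpha G u)%R.
pose target := ((d + s.+1)%:R * pw alpha 8 - leaf_total)%R.
have bound_le : (SO_bound alpha G <=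
    gain alpha x + gain alpha y + gain alpha rest + target)%R.
  rewrite /SO_bound /target addrA lerD2r lerD ?edges_term//.
  rewrite (bigD1 (v i)) //= (bigD1 (v j)) //= -!/(excess _) exE eyE addrA lerD2l.
  by rewrite -restE; apply: sum_gain.
have bound := le_trans (SO_le_bound alpha_gt0 alpha_lt1 conn card3) bound_le.
have all_loss := sum_leaf_loss_ge le (subxx (leaves G)).
rewrite card_leaves -natr1 in all_loss.
have lossM : (0 < loss alpha s.+2)%R by exact: loss_gt0.
(* Excess elsewhere costs more than [loss 2], even if every leaf has only the least possible loss
   [loss s.+2]. *)
case: (posnP rest) => [rest0|rest0]; last first.
  left; have := gain_three alpha_gt0 alpha_lt1 x0 y0 rest0 tot.
  move: bound all_loss loss_end_le; rewrite /U_value /target -/leaf_total; lra.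
rewrite rest0 gain0 addr0 in bound bound_le; rewrite rest0 addn0 in tot.
have ends := sum_leaf_loss_ends le.
have sE : (s%:R = s.-1%:R + 1 :> R)%R by rewrite natr1 prednK.
have small u : u != v i -> u != v j -> deg u <= 2.
  by move=> ui uj; have := rest_ge u ui uj; rewrite rest0 /excess; nat_lia.
have g2 := gain_two alpha_gt0 alpha_lt1 x0 y0 tot.
(* One end leaf hangs at degree 2, the other at degree [t]. If [t < s.+2], its loss exceeds
   [loss s.+2]; if [t = s.+2] but v_i and v_j are adjacent, the edge bound is strict. *)
have one_end t : (loss alpha 2 + loss alpha t + s.-1%:R * loss alpha s.+2 <=
      \sum_(x in leaves G) leaf_loss alpha G x)%R -> t <= s.+2 ->
    (SO G alpha < U_value alpha (d + s.+1) d s)%R \/ t = s.+2 /\ j = i.+2.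
  move=> sum_ge; rewrite leq_eqVlt.
  case/orP=> [/eqP tE|/(loss_decreasing alpha_gt0 alpha_lt1) lt].
    have [|jiS] := eqVneq j i.+2; [by right|left].
    have adj_ij : G (v i) (v j) by rewrite (_ : j = i.+1) ?vg.1; nat_lia.
    have := SO_lt_bound alpha_gt0 alpha_lt1 conn card3 adj_ij di dj.
    move: sum_ge bound_le loss_end_le g2.
    by rewrite tE /U_value /target -/leaf_total sE; lra.
  left; move: bound loss_end_le g2 sum_ge lt.
  by rewrite /U_value /target -/leaf_total sE; lra.
have [d1|d1] := leqP (deg (v 1)) 2.
  have {}d1 : deg (v 1) = 2 by have := @inner_degree 1; nat_lia.
  rewrite d1 in ends; case: (one_end _ ends (le _)) => [|[dE jE]]; [by left|right].
  exists i; split; rewrite -?jE //; right; split => //.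
  have : (v d.-1 == v i) || (v d.-1 == v j).
    apply: contraTT isT; rewrite negb_or => /andP[/small sm /sm]; rewrite dE; nat_lia.
  by case/orP => /eqP /v_inj; nat_lia.
have [d2|d2] := leqP (deg (v d.-1)) 2.
  have {}d2 : deg (v d.-1) = 2 by have := @inner_degree d.-1; nat_lia.
  rewrite d2 [X in (X + _ <= _)%R]addrC in ends.
  case: (one_end _ ends (le _)) => [|[dE jE]]; [by left|right].
  exists i; split; rewrite -?jE //; left; split => //.
  have : (v 1 == v i) || (v 1 == v j).
    apply: contraTT isT; rewrite negb_or => /andP[/small sm /sm]; rewrite dE; nat_lia.
  by case/orP => /eqP /v_inj; nat_lia.
(* Now v_1 and v_(d-1) both have degree at least 3, so they are v_i and v_j; as [j <= i.+2], this
   forces d = 4. *)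
have iE : i = 1.
  have : (v 1 == v i) || (v 1 == v j).
    by rewrite -[_ || _]negbK negb_or; apply/negP => /andP[/small sm /sm]; nat_lia.
  by case/orP => /eqP /v_inj; nat_lia.
have jE : j = d.-1.
  have : (v d.-1 == v i) || (v d.-1 == v j).
    by rewrite -[_ || _]negbK negb_or; apply/negP => /andP[/small sm /sm]; nat_lia.
  by case/orP => /eqP /v_inj; nat_lia.
have dE : d = 4 by nat_lia.
have value : U_value alpha (d + s.+1) d s = (gain alpha s + gain alpha 1 +
    (d + s.+1)%:R * pw alpha 8 - s%:R * loss alpha s.+2 - loss alpha 3)%R.
  by rewrite /U_value dE.
have [big|] := boolP ((1 < x) && (1 < y)).
  left; case/andP: big => x1 y1.
  have := gain_two_big alpha_gt0 alpha_lt1 x1 y1 tot.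
  by move: bound all_loss; rewrite value /target -/leaf_total; lra.
rewrite iE in xE; rewrite jE in yE.
rewrite xE yE in ends; rewrite xE yE value.
(* The excesses are 1 and [t]; for [t < s] the gain is smaller and the loss at the corresponding end
   is larger. *)
have finish t : x = 1 /\ y = t \/ y = 1 /\ x = t -> t < s ->
    (SO G alpha < gain alpha s + gain alpha 1 +
    (d + s.+1)%:R * pw alpha 8 - s%:R * loss alpha s.+2 - loss alpha 3)%R.
  move=> xyt ts; have gt := ltr_gain alpha_gt0 alpha_lt1 ts.
  have lt : (loss alpha s.+2 < loss alpha t.+2)%R by exact: loss_decreasing.
  case: xyt => -[e1 e2]; rewrite e1 e2 in bound ends.
    by move: bound ends gt lt; rewrite /target -/leaf_total sE; lra.
  by move: bound ends gt lt; rewrite /target -/leaf_total sE; lra.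
have w1 : G w (v 1) by rewrite -iE.
have w3 : G w (v 3) by rewrite (_ : 3 = j) //; nat_lia.
have [xs|xs] := eqVneq x s.
  right; exists 1; split; rewrite ?dE //.
  by left; rewrite xs.
have [ys|ys] := eqVneq y s.
  right; exists 1; split; rewrite ?dE //.
  by right; rewrite ys.
rewrite negb_and -!leqNgt => /orP[x1|y1]; left.
  by apply: (finish y); [left|]; nat_lia.
by apply: (finish x); [right|]; nat_lia.
Qed.

End FullLeaves.

Lemma SO_lt_or_attached : (SO G alpha < U_value alpha (d + s.+1) d s)%R \/
  exists i, [/\ 0 < i, i.+2 < d, G w (v i), G w (v i.+2) &
    i = 1 /\ deg (v 1) = s.+2 \/ i.+3 = d /\ deg (v d.-1) = s.+2].
Proof.
have [few|many] := leqP #|leaves G| s; first by left; exact: few_leaves.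
by apply: full_leaves; apply/eqP; rewrite eqn_leq many card_leaves_le.
Qed.

End Extremal.

(** * The graph U(n, d) *)

Section ExtremalGraph.

Variables (m d s : nat).
Hypotheses (d4 : 4 <= d) (s1 : 0 < s) (mE : m = d + s).

(** Indexes [m + 1] edges of U(n, d) by 0, ..., [m]: for [j > 0] the larger endpoint is [j], and the
    spare index 0 denotes the edge from v_3, vertex 2, to u_0, vertex [d]. *)
Definition arc_tail (j : nat) : nat := if j == 0 then 2 else if j < d then j.-1 else 0.
Definition arc_head (j : nat) : nat := if j == 0 then d else j.

Lemma U_arc_tail_head j : j <= m -> U_arc d (arc_tail j) (arc_head j).
Proof.
rewrite /U_arc /arc_tail /arc_head; case: j => [|j] /=.
  by rewrite eqxx !orbT andbT; lia.
case: (ltnP j.+1 d) => jd jm /=; first by rewrite eqxx ltnS leqnn.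
by case: (ltngtP j.+1 d) jd => // _ _; rewrite ?eqxx ?orbT.
Qed.

Lemma arc_lt j : j <= m -> arc_tail j < arc_head j <= m.
Proof.
rewrite /arc_tail /arc_head; case: j => [|j] /=; first by lia.
by case: (ltnP j.+1 d); lia.
Qed.

Definition U_edge (j : 'I_m.+1) : {set 'I_m.+1} :=
  [set inord (arc_tail j); inord (arc_head j)].

Lemma inord_arc (j : 'I_m.+1) :
  [/\ (inord (arc_tail j) : 'I_m.+1) = arc_tail j :> nat,
      (inord (arc_head j) : 'I_m.+1) = arc_head j :> nat
    & inord (arc_tail j) != inord (arc_head j) :> 'I_m.+1].
Proof.
have jm : j <= m by rewrite -ltnS ltn_ord.
have := arc_lt jm => lt; rewrite -val_eqE /= !inordK; try by lia.
by split => //; rewrite neq_ltn; lia.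
Qed.

Lemma U_edge_inj : injective U_edge.
Proof.
move=> i j /setP e; apply: val_inj => /=.
have [ti hi neqi] := inord_arc i; have [tj hj neqj] := inord_arc j.
have im : i <= m by rewrite -ltnS ltn_ord.
have jm : j <= m by rewrite -ltnS ltn_ord.
have := e (inord (arc_tail i)); have := e (inord (arc_head i)).
rewrite !inE !eqxx orbT -!val_eqE /= ti hi tj hj.
have := arc_lt im; have := arc_lt jm.
have : arc_tail i = arc_tail j -> arc_head i = arc_head j -> i = j :> nat.
  rewrite /arc_tail /arc_head; case: (nat_of_ord i) (nat_of_ord j) => [|k] [|l] //=.
    by move=> + dE; rewrite -dE ltnn.
  by move=> + dE; rewrite dE ltnn.
lia.
Qed.

Lemma U_edge_mem j : U_edge j \in edges (U m.+1 d).
Proof.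
have [tj hj _] := inord_arc j; rewrite mem_edges /= /U_rel /= tj hj.
by rewrite U_arc_tail_head// -ltnS ltn_ord.
Qed.

Lemma edges_U_ge : m < #|edges (U m.+1 d)|.
Proof.
have : U_edge @: setT \subset edges (U m.+1 d).
  by apply/subsetP => _ /imsetP[j _ ->]; apply: U_edge_mem.
move/subset_leq_card; rewrite card_imset; last exact: U_edge_inj.
by rewrite cardsT card_ord.
Qed.

Lemma degree_U_ge (l : seq nat) k : k <= m -> uniq l ->
  {in l, forall i, i <= m /\ (U_arc d k i || U_arc d i k)} ->
  size l <= degree (U m.+1 d) (inord k).
Proof.
move=> km ul lP; rewrite -(size_map (inord : nat -> 'I_m.+1)).
apply: degree_ge => [|_ /mapP[i il ->]].
  rewrite map_inj_in_uniq// => i j /lP[im _] /lP[jm _] /(congr1 val) /=.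
  by rewrite !inordK.
by have [im] := lP i il; rewrite /= /U_rel /= !inordK.
Qed.

(** Vertex 0 is v_1, vertex 2 is v_3, and [d.-1] is the end v_d. Lower bounds by these values
    suffice, because edge weights increase with the degrees. *)
Definition U_degree (k : nat) : nat :=
  if k == 0 then s.+2 else if k == 2 then 3
  else if (k == d.-1) || (d < k) then 1 else 2.

Lemma U_degree_le k : k <= m -> U_degree k <= degree (U m.+1 d) (inord k).
Proof.
move=> km; rewrite /U_degree.
have [k0|k0] := eqVneq k 0.
  rewrite -[s.+2](_ : size (1 :: iota d s.+1) = _); last by rewrite /= size_iota.
  apply: degree_U_ge => //.
    by rewrite cons_uniq iota_uniq andbT mem_iota; lia.
  by move=> i; rewrite inE mem_iota /U_arc => ik; split; lia.
have [k2|k2] := eqVneq k 2.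
  apply: (@degree_U_ge [:: 1; 3; d]) => //; first by rewrite /= !inE; lia.
  by move=> i; rewrite !inE /U_arc => ik; split; lia.
case: ifP => kd.
  have [lt|ge] := leqP k d.
    apply: (@degree_U_ge [:: k.-1]) => //.
    by move=> i; rewrite !inE /U_arc => ik; split; lia.
  apply: (@degree_U_ge [:: 0]) => //.
  by move=> i; rewrite !inE /U_arc => ik; split; lia.
have [->|ne] := eqVneq k d.
  apply: (@degree_U_ge [:: 0; 2]) => //; first lia.
  by move=> i; rewrite !inE /U_arc => ik; split; lia.
apply: (@degree_U_ge [:: k.-1; k.+1]) => //; first by rewrite /= !inE; lia.
by move=> i; rewrite !inE /U_arc => ik; split; lia.
Qed.

(** * The general Sombor index of U(n, d) *)

Section Value.

Variables (R : realType) (alpha : R).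
Hypothesis alpha_gt0 : (0 < alpha)%R.

Lemma SO_U_ge_sum : (\sum_(0 <= j < m.+1)
    edge_weight alpha (U_degree (arc_tail j)) (U_degree (arc_head j)) <=
  SO (U m.+1 d) alpha)%R.
Proof.
rewrite big_mkord /SO (bigID (mem (U_edge @: setT))) /=.
rewrite -[leLHS]addr0; apply: lerD; last by apply: sumr_ge0 => f _; apply: powR_ge0.
rewrite (eq_bigl (mem (U_edge @: setT))); last first.
  move=> f /=; apply: andb_idl => /imsetP[j _ ->]; exact: U_edge_mem.
rewrite big_imset /=; last by move=> i j _ _; apply: U_edge_inj.
rewrite [leRHS](eq_bigl xpredT) => [|j]; last by rewrite inE.
apply: ler_sum => j _; have [_ _ neq] := inord_arc j.
rewrite big_setU1 ?inE//= big_set1; apply: ler_pw => //.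
have jm : j <= m by rewrite -ltnS ltn_ord.
have lt := arc_lt jm.
by apply: leq_add; rewrite leq_sqr; apply: U_degree_le; lia.
Qed.

Lemma SO_U_ge : (U_value alpha m.+1 d s <= SO (U m.+1 d) alpha)%R.
Proof.
apply: le_trans SO_U_ge_sum.
pose F j := edge_weight alpha (U_degree (arc_tail j)) (U_degree (arc_head j)).
have FE j a b : U_degree (arc_tail j) = a -> U_degree (arc_head j) = b ->
  F j = edge_weight alpha a b by move=> ta hb; rewrite /F ta hb.
have tail1 j : 0 < j < d -> arc_tail j = j.-1.
  by move=> jd; rewrite /arc_tail; do 2?case: ifP => ? //; lia.
have tail0 j : d <= j -> arc_tail j = 0.
  by move=> jd; rewrite /arc_tail; do 2?case: ifP => ? //; lia.
have headE j : 0 < j -> arc_head j = j by case: j.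
have deg0 : U_degree 0 = s.+2 by [].
have deg1 k : k = d.-1 \/ d < k -> U_degree k = 1.
  by move=> kd; rewrite /U_degree; do 3?case: ifP => ? //; lia.
have deg2 k : 0 < k <= d -> k != 2 -> k != d.-1 -> U_degree k = 2.
  by move=> kd k2 k1; rewrite /U_degree; do 3?case: ifP => ? //; lia.
have high : (\sum_(d <= j < m.+1) F j =
    edge_weight alpha s.+2 2 + s%:R * edge_weight alpha s.+2 1)%R.
  rewrite big_ltn; last lia.
  congr (_ + _)%R; first by apply: FE; [rewrite tail0|rewrite headE ?deg2 //]; lia.
  rewrite (eq_big_nat _ _ (F2 := fun=> edge_weight alpha s.+2 1)).
    by rewrite sumr_const_nat mulr_natl mE subSS addKn.
  by move=> j dj; apply: FE; [rewrite tail0|rewrite headE ?deg1 //]; lia.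
have F0 : F 0 = edge_weight alpha 3 2.
  by apply: FE => //; rewrite /arc_head /= deg2 //; lia.
have F1 : F 1 = edge_weight alpha s.+2 2.
  by apply: FE; [rewrite tail1 //|rewrite headE ?deg2 //]; lia.
have F2 : F 2 = edge_weight alpha 2 3.
  by apply: FE; [rewrite tail1 ?deg2 //|done]; lia.
have low : (\sum_(0 <= j < d) F j = F 0 + F 1 + F 2 + \sum_(3 <= j < d) F j)%R.
  by do 3 (rewrite big_ltn; last lia); rewrite !addrA.
rewrite -/(F _) (@big_cat_nat _ _ _ d) //=; last by lia.
rewrite high low F0 F1 F2 /U_value /gain /loss /edge_weight.
rewrite -[(2 ^ 2 + 3 ^ 2)%N]/13 -[(3 ^ 2 + 2 ^ 2)%N]/13.
rewrite -[(2 ^ 2)%N]/4 -[(1 ^ 2)%N]/1.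
set P := pw alpha (s.+2 ^ 2 + 4); set Q := pw alpha (s.+2 ^ 2 + 1).
have -> : (m.+1%:R = d%:R + s%:R + 1 :> R)%R by rewrite mE -natr1 natrD.
have -> : (s.+2%:R = s%:R + 2 :> R)%R by rewrite -addn2 natrD.
(* For d = 4 the one path edge left joins v_3 to the leaf v_4; otherwise those left have degrees 3
   and 2, then [d - 5] times 2 and 2, and finally 2 and 1. *)
have [d4E|d5] := eqVneq d 4.
  have -> : (\sum_(3 <= j < d) F j = edge_weight alpha 3 1)%R.
    by rewrite d4E big_nat1; apply: FE; [rewrite tail1 //|rewrite headE ?deg1 //]; lia.
  rewrite d4E /edge_weight -[(3 ^ 2 + 4)%N]/13 -[(3 ^ 2 + 1 ^ 2)%N]/10.
  lra.
have -> : (\sum_(3 <= j < d) F j = edge_weight alpha 3 2 +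
    (d%:R - 5) * edge_weight alpha 2 2 + edge_weight alpha 2 1)%R.
  have dS : d.-1.+1 = d by lia.
  rewrite big_ltn; last lia.
  rewrite -[in LHS]dS big_nat_recr; last lia.
  rewrite /= addrA; congr (_ + _ + _)%R.
  - by apply: FE; [rewrite tail1 //|rewrite headE ?deg2 //]; lia.
  - rewrite (eq_big_nat _ _ (F2 := fun=> edge_weight alpha 2 2)).
      rewrite sumr_const_nat (_ : d.-1 - 4 = d - 5); last lia.
      by rewrite -[LHS]mulr_natl natrB //; lia.
    by move=> j dj; apply: FE; [rewrite tail1 ?deg2 //|rewrite headE ?deg2 //]; lia.
  - by apply: FE; [rewrite tail1 ?deg2 //|rewrite headE ?deg1 //]; lia.
rewrite /edge_weight -[(3 ^ 2 + 2 ^ 2)%N]/13 -[(2 ^ 2 + 2 ^ 2)%N]/8.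
rewrite -[(2 ^ 2 + 1 ^ 2)%N]/5. lra.
Qed.

End Value.

(** Apart from v_0 and v_2, only the [s] vertices off the geodesic can be neighbours of v_1, so
    degree [s.+2] makes all of them neighbours. This embeds U(n, d) in G, and counting edges makes
    the embedding an isomorphism. *)
Lemma attached_isomorphic (T : finType) (G : sgraph T) (v : nat -> T) w :
  #|T| = m.+1 -> #|edges G| <= m.+1 -> geodesic G v d -> w \notin on_geodesic v d ->
  G w (v 1) -> G w (v 3) -> degree G (v 1) = s.+2 -> isomorphic G (U m.+1 d).
Proof.
move=> cardT edges_le vg w_off w1 w3 deg1.
have v_inj := geodesic_inj vg.
have card_off : #|~: on_geodesic v d| = s.
  by have := cardsC (on_geodesic v d); rewrite (card_on_geodesic vg) cardT; lia.
have nbhd : [set u | G (v 1) u] = [set v 0; v 2] :|: ~: on_geodesic v d.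
  apply/eqP; rewrite eqEcard; apply/andP; split; last first.
    rewrite -/(degree G (v 1)) deg1; apply: leq_trans (leq_card_setU _ _) _.
    by rewrite cards2 card_off; case: (_ != _); lia.
  apply/subsetP => u; rewrite !inE => u1.
  have [/on_geodesicP[i id uE]|//] := boolP (u \in on_geodesic v d).
    rewrite uE in u1 *.
    by case: (geodesic_adj vg _ id u1) => [|->|[<-]]; rewrite ?eqxx ?orbT //; lia.
  by rewrite orbT.
have off_adj u : u \notin on_geodesic v d -> G (v 1) u.
  by move=> uo; have /setP/(_ u) := nbhd; rewrite !inE uo orbT => ->.
pose h := rcons [seq v i.+1 | i <- iota 0 d] w.
(* The vertex [v 0] is among the remaining ones and plays the part of a pendant neighbour of v_1. *)
pose sq := h ++ [seq x <- enum T | x \notin h].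
have w_notin : w \notin [seq v i.+1 | i <- iota 0 d].
  apply: contra w_off => /mapP[i]; rewrite mem_iota => id ->.
  by apply/on_geodesicP; exists i.+1 => //; lia.
have sq_uniq : uniq sq.
  rewrite cat_uniq rcons_uniq w_notin filter_uniq ?enum_uniq// andbT /=.
  apply/andP; split.
    rewrite map_inj_in_uniq ?iota_uniq// => i j; rewrite !mem_iota => id jd.
    by move/v_inj => e; apply: succn_inj; apply: e; lia.
  by apply/hasPn => x; rewrite mem_filter => /andP[].
have sq_mem x : x \in sq.
  by rewrite mem_cat mem_filter mem_enum andbT orbN.
have size_sq : size sq = m.+1.
  by rewrite -cardT -(card_uniqP sq_uniq); apply: eq_card => x; rewrite sq_mem.
have size_h : size h = d.+1 by rewrite size_rcons size_map size_iota.
have size_rest : size [seq x <- enum T | x \notin h] = s.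
  move: size_sq; rewrite /sq size_cat size_h mE => /eqP.
  by rewrite addSn eqSS eqn_add2l => /eqP.
pose g (i : 'I_m.+1) := nth w sq i.
have g_path (i : 'I_m.+1) : i < d -> g i = v i.+1.
  move=> id; rewrite /g nth_cat size_h ltnS (ltnW id) nth_rcons size_map size_iota id.
  by rewrite (nth_map 0) ?size_iota// nth_iota.
have g_w (i : 'I_m.+1) : i = d :> nat -> g i = w.
  by move=> id; rewrite /g nth_cat size_h id ltnSn nth_rcons size_map size_iota ltnn eqxx.
have g_off (i : 'I_m.+1) : d < i -> G (v 1) (g i).
  move=> di; have : g i \in [seq x <- enum T | x \notin h].
    rewrite /g nth_cat size_h ltnNge di /=; apply: mem_nth.
    by rewrite size_rest; move: (ltn_ord i) mE; lia.
  rewrite mem_filter => /andP[nh _].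
  have [/on_geodesicP[j jd jE]|/off_adj//] := boolP (g i \in on_geodesic v d).
  case: j jd jE => [|j] jd jE; first by rewrite jE adj_sym vg.1 //; lia.
  case/negP: nh; rewrite jE mem_rcons inE; apply/orP; right.
  by apply/mapP; exists j => //; rewrite mem_iota.
have arc_adj (i j : 'I_m.+1) : U_arc d i j -> G (g i) (g j).
  rewrite /U_arc => /andP[ij /or3P[/andP[/eqP jE jd]|/andP[id /eqP jd]|/andP[/eqP i0 dj]]].
  - by rewrite !g_path ?jE; [apply: vg.1|..]; lia.
  - rewrite (g_w j)// g_path; last by lia.
    by rewrite adj_sym; case/orP: id => /eqP->.
  - by rewrite g_path ?i0; [apply: g_off|lia].
have U_adj i j : U m.+1 d i j -> G (g i) (g j).
  by case/orP => /arc_adj //; rewrite adj_sym.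
have g_inj : injective g.
  move=> i j /eqP; rewrite nth_uniq ?size_sq// => /eqP; exact: val_inj.
have [f gK fK] : bijective g by apply: inj_card_bij; rewrite ?cardT ?card_ord.
have gg_inj : injective (fun p : 'I_m.+1 * 'I_m.+1 => (g p.1, g p.2)).
  by move=> [i j] [i' j'] [/g_inj-> /g_inj->].
(* Adjacent pairs go injectively to adjacent pairs, of which G has no more than U(n, d), so all are
   reached. *)
have pairs : (fun p : 'I_m.+1 * 'I_m.+1 => (g p.1, g p.2)) @:
    [set p | U m.+1 d p.1 p.2] = [set p | G p.1 p.2].
  apply/eqP; rewrite eqEcard; apply/andP; split.
    apply/subsetP => q /imsetP[p up ->]; rewrite !inE in up *.
    exact: U_adj.
  rewrite (card_imset _ gg_inj) !card_adjacent leq_double.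
  exact: leq_trans edges_le edges_U_ge.
exists f; split; first by exists g.
move=> x y; rewrite -{2}(fK x) -{2}(fK y).
have /setP/(_ (g (f x), g (f y))) := pairs; rewrite [RHS]inE => <-.
by rewrite (mem_imset _ (f x, f y) gg_inj) inE.
Qed.

End ExtremalGraph.

Theorem theorem3 (R : realType) (alpha : R) (n d : nat)
    (T : finType) (G : sgraph T) :
  (0 < alpha)%R -> (alpha < 1)%R ->
  4 <= d -> d + 2 <= n ->
  #|T| = n -> unicyclic G -> diameter G = d ->
  (SO G alpha <= SO (U n d) alpha)%R /\
  (SO G alpha = SO (U n d) alpha <-> isomorphic G (U n d)).
Proof.
move=> alpha_gt0 alpha_lt1 d4 dn cardT uniG diamG.
pose s := n - d.+1.
have nE : n = (d + s).+1 by rewrite /s; lia.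
have s1 : 0 < s by rewrite /s; lia.
have conn := uniG.1.
have edges_le := unicyclic_edges uniG.
suff [lt|iso] : (SO G alpha < SO (U n d) alpha)%R \/ isomorphic G (U n d).
- split; first exact: ltW.
  by split => [e|/(SO_isomorphic alpha)//]; move: lt; rewrite e ltxx.
- by rewrite (SO_isomorphic alpha iso).
rewrite nE in cardT *.
have [v vg] := diameter_geodesic conn diamG.
have [C [cycC _]] := uniG.2.
have [w [a [b [w_off ab [wa wb] [deg_a deg_b]]]]] := cycle_off_geodesic vg cycC.
have cardT' : #|T| = d + s.+1 by rewrite addnS.
have SO_U := SO_U_ge d4 s1 erefl alpha_gt0.
case: (SO_lt_or_attached alpha_gt0 alpha_lt1 d4 s1 cardT' conn edges_le vg w_off
  ab wa wb deg_a deg_b) => [lt|[i [i0 id wi wi2 []]]].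
- by left; apply: lt_le_trans SO_U; rewrite -addnS.
- case=> i1 deg1; right; rewrite i1 in wi wi2.
  apply: (attached_isomorphic d4 s1 erefl cardT _ vg w_off wi wi2 deg1).
  by rewrite -cardT.
- case=> iE deg1; right.
  (* Reversal puts v_(d-1) = v_(i+2) at position 1 and v_(d-3) = v_i at position 3. *)
  apply: (attached_isomorphic d4 s1 erefl cardT _ (geodesic_rev vg) (w := w)).
  + by rewrite -cardT.
  + apply/negP => /on_geodesicP[k kd wE]; case/negP: w_off.
    by apply/on_geodesicP; exists (d - k); rewrite ?leq_subr.
  + by rewrite (_ : d - 1 = i.+2) //; lia.
  + by rewrite (_ : d - 3 = i) //; lia.
  + by rewrite subn1.
Qed.
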